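(* Let $f$ be a solution of $\partial_t f=Q(f)$ with initial condition $f_0$ of mass $\rho$. If $\rho>\rho_c$ and $J_{f_0}\neq0$, then $f$ does not converge to the uniform distribution; that is, it is not the case that $$\lim_{t\to\infty}|J_f(t)|=0\quad\text{and}\quad\lim_{t\to\infty}\|f(t)-\rho\|_{H^s}=0\ \text{ for all } s\in\mathbb R.$$
   Context: Let $n\ge 2$ and let $\mathbb S$ be the unit sphere of $\mathbb R^n$ with the uniform probability measure $d\omega$. $\nabla_\omega$, $\nabla_\omega\cdot$, $\Delta_\omega$ are the gradient, divergence and Laplace–Beltrami operator on $\mathbb S$; $P_{\omega^\perp}=\mathrm{Id}-\omega\otimes\omega$; $H^s=H^s(\mathbb S)$ is the usual Sobolev space. The functions $\nu:[0,\infty)\to[0,\infty)$ and $\tau:[0,\infty)\to(0,\infty)$ are such that $r\mapsto\nu(r)/r$ and $r\mapsto\tau(r)$ are Lipschitz and bounded; $\tau_0=\tau(0)>0$. The function $k(r)=\nu(r)/\tau(r)$ is increasing. The critical density is $\rho_c=\lim_{r\to0}\frac{n\,r}{k(r)}\in(0,+\infty]$. For $f$ on $\mathbb S$, $J_f=\int_{\mathbb S}\omega f\,d\omega$, $\Omega_f=J_f/|J_f|$, and $$Q(f)=-\nu(|J_f|)\nabla_\omega\cdot(P_{\omega^\perp}\Omega_f\,f)+\tau(|J_f|)\Delta_\omega f$$ (with $Q(f)=\tau_0\Delta_\omega f$ if $J_f=0$). For every finite nonnegative measure $f_0$ (which lies in some $H^{s}(\mathbb S)$) there is a unique global weak solution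 $f$ of $\partial_t f=Q(f)$, $f(0)=f_0$, with $f\in C^1((0,\infty),C^\infty(\mathbb S))$; the mass $\int_{\mathbb S}f\,d\omega$ is conserved. *)

(* Defs.v *)
From mathcomp Require Import all_boot all_order all_algebra.
From mathcomp Require Import all_classical all_reals all_analysis.

Set Implicit Arguments.
Unset Strict Implicit.
Unset Printing Implicit Defensive.

Import Order.TTheory GRing.Theory Num.Theory.
Import numFieldNormedType.Exports.

Local Open Scope classical_set_scope.
Local Open Scope ring_scope.

Section Sphere.
Context {R : realType} {n : nat}.
Implicit Types (w x y : 'rV[R]_n) (g phi Y : 'rV[R]_n -> R).

(* The norm that the library puts on ['rV[R]_n] is the sup norm, so the
   Euclidean structure is introduced by hand. *)
Definition dotp x y : R := \sum_i x ord0 i * y ord0 i.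
Definition enorm x : R := Num.sqrt (dotp x x).
Definition sphere : set 'rV[R]_n := [set w | enorm w = 1].

(* A function (or vector field) on the sphere is encoded by a function on R^n
   of which only the values on [sphere] matter. All differential operators are
   applied to its extension to R^n \ {0} that is homogeneous of degree 0; for
   this extension the Euclidean gradient, and the Euclidean divergence of a
   tangent field, coincide on the sphere with the intrinsic ones. *)
Definition ext0 {V : Type} (g : 'rV[R]_n -> V) : 'rV[R]_n -> V :=
  fun x => g ((enorm x)^-1 *: x).

Definition basis_vec (i : 'I_n) : 'rV[R]_n := delta_mx ord0 i.

Definition sgrad g : 'rV[R]_n -> 'rV[R]_n :=
  fun w => \row_i 'D_(basis_vec i) (ext0 g) w.

Definition sdiv (A : 'rV[R]_n -> 'rV[R]_n) : 'rV[R]_n -> R :=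
  fun w => \sum_i 'D_(basis_vec i) (ext0 (fun x => A x ord0 i)) w.

Definition laplace_beltrami g : 'rV[R]_n -> R := sdiv (sgrad g).

(* [iter_sgrad [:: i1; ..; ik] g] is the iterated derivative of [g] along the
   tangent fields w |-> P_{w^perp} e_i, which span every tangent space. *)
Definition iter_sgrad (s : seq 'I_n) g : 'rV[R]_n -> R :=
  foldr (fun i h w => sgrad h w ord0 i) g s.

Definition smooth_sphere g : Prop :=
  forall (s : seq 'I_n) w, sphere w -> differentiable (ext0 (iter_sgrad s g)) w.

(* C^1((0,+oo), C^oo(S)), where C^oo(S) has its Frechet topology: uniform
   convergence on S of all iterated derivatives. *)
Definition C1_smooth_sphere (u : R -> 'rV[R]_n -> R) : Prop :=
  exists du : R -> 'rV[R]_n -> R, forall t : R, 0 < t ->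
    [/\ smooth_sphere (u t),
        smooth_sphere (du t),
        forall s : seq 'I_n,
          {uniform sphere,
            (fun (h : R) w =>
               h^-1 * (iter_sgrad s (u (t + h)) w - iter_sgrad s (u t) w))
              @ 0^' --> iter_sgrad s (du t)}
      & forall s : seq 'I_n,
          {uniform sphere,
            (fun t' : R => iter_sgrad s (du t')) @ t --> iter_sgrad s (du t)}].

(* P_{w^perp} = Id - w (x) w; it is symmetric, so it may act on row vectors
   from the right. *)
Definition proj_perp w : 'M[R]_n := 1%:M - w^T *m w.

End Sphere.

Arguments sphere : clear implicits.

(* R^n with its Borel sigma-algebra. *)
Definition borel_rV (R : realType) (n : nat) :=
  g_sigma_algebraType (@open 'rV[R]_n).

(* The uniform probability measure of the sphere is the only Borel probability
   measure carried by the sphere that is invariant under the orthogonal group;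
   it is regarded as a measure on R^n. *)
Definition uniform_sphere {R : realType} {n : nat}
    (sigma : probability (borel_rV R n) R) : Prop :=
  sigma (sphere R n) = 1%E /\
  forall U : 'M[R]_n, U *m U^T = 1%:M ->
    forall A : set (borel_rV R n), measurable A ->
      sigma ((fun w : 'rV[R]_n => w *m U) @^-1` A) = sigma A.

(* Distributions on the sphere, as functionals on test functions; they are only
   ever evaluated at smooth functions on the sphere. Those that occur below are
   the finite measures, the smooth densities, and what is obtained from these by
   differentiation and by multiplication with smooth functions. *)
Definition sphere_distribution (R : realType) (n : nat) : Type :=
  ('rV[R]_n -> R) -> R.

Section Distributions.
Context {R : realType} {n : nat}.
Implicit Types (T : sphere_distribution R n) (phi Y : 'rV[R]_n -> R).

Definition dist_measure (mu : {measure set (borel_rV R n) -> \bar R}) :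
    sphere_distribution R n :=
  fun phi => \int[mu]_(w in sphere R n) phi w.

Definition dist_density (sigma : {measure set (borel_rV R n) -> \bar R})
    (g : 'rV[R]_n -> R) : sphere_distribution R n :=
  fun phi => \int[sigma]_(w in sphere R n) (g w * phi w).

(* Product of a vector field and a scalar distribution: a vector-valued
   distribution, given by its components in R^n. *)
Definition dist_field (X : 'rV[R]_n -> 'rV[R]_n) T : 'I_n -> sphere_distribution R n :=
  fun i phi => T (fun w => X w ord0 i * phi w).

(* Distributional divergence and Laplace-Beltrami operator, by duality. *)
Definition dist_div (A : 'I_n -> sphere_distribution R n) : sphere_distribution R n :=
  fun phi => - \sum_i A i (fun w => sgrad phi w ord0 i).

Definition dist_laplace T : sphere_distribution R n :=
  fun phi => T (laplace_beltrami phi).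

Definition momentum T : 'rV[R]_n := \row_i T (fun w => w ord0 i).

Definition direction T : 'rV[R]_n := (enorm (momentum T))^-1 *: momentum T.

Definition Qop (nu tau : R -> R) T : sphere_distribution R n :=
  let J := momentum T in
  if J == 0 then fun phi => tau 0 * dist_laplace T phi
  else fun phi =>
    - nu (enorm J)
      * dist_div (dist_field (fun w => direction T *m proj_perp w) T) phi
    + tau (enorm J) * dist_laplace T phi.

(* Global weak solution of d_t f = Q(f), f(0) = f0, with the regularity
   f \in C^1((0,+oo), C^oo(S)): the equation and the initial condition hold in
   the sense of distributions. *)
Definition is_solution (sigma : {measure set (borel_rV R n) -> \bar R})
    (nu tau : R -> R) (f0 : {measure set (borel_rV R n) -> \bar R})
    (f : R -> sphere_distribution R n) : Prop :=
  [/\ exists2 u : R -> 'rV[R]_n -> R, C1_smooth_sphere u &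
        forall (t : R) phi, 0 < t -> smooth_sphere phi ->
          f t phi = dist_density sigma (u t) phi,
      forall (t : R) phi, 0 < t -> smooth_sphere phi ->
        is_derive t 1 (fun t' : R => f t' phi) (Qop nu tau (f t) phi),
      forall phi, smooth_sphere phi -> f 0 phi = dist_measure f0 phi
    & forall phi, smooth_sphere phi -> f t phi @[t --> (0 : R)^'+] --> f 0 phi].

(* Sobolev norms of any real order, from the spectral decomposition of the
   Laplace-Beltrami operator:
     ||T||_{H^s}^2 = \sum_l (1 + l (l + n - 2))^s ||P_l T||_{L^2}^2,
   with P_l the projection on the spherical harmonics of degree l. *)
Definition sphere_eigenvalue (l : nat) : R := l%:R * (l%:R + n%:R - 2).

Definition spherical_harmonic (l : nat) Y : Prop :=
  smooth_sphere Y /\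
  forall w, sphere R n w -> laplace_beltrami Y w = - sphere_eigenvalue l * Y w.

(* ||P_l T||_{L^2}^2, by duality since the harmonics of degree l form a
   finite-dimensional space. *)
Definition harmonic_energy (sigma : {measure set (borel_rV R n) -> \bar R})
    (l : nat) T : \bar R :=
  ereal_sup [set ((T Y) ^+ 2)%:E | Y in
    [set Y | spherical_harmonic l Y /\
             \int[sigma]_(w in sphere R n) (Y w ^+ 2) <= 1]].

Definition sobolev_norm (sigma : {measure set (borel_rV R n) -> \bar R})
    (s : R) T : \bar R :=
  ((\sum_(0 <= l <oo)
     ((1 + sphere_eigenvalue l) `^ s)%:E * harmonic_energy sigma l T)
   `^ 2^-1)%E.

End Distributions.

Definition kfun {R : realType} (nu tau : R -> R) : R -> R :=
  fun r => nu r / tau r.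

Definition critical_density {R : realType} (n : nat) (k : R -> R) : \bar R :=
  lim ((n%:R * r / k r)%:E @[r --> (0 : R)^'+]).

(* Main.v *)
Require Import Defs.
From mathcomp Require Import all_boot all_order fingroup perm all_algebra.
From mathcomp Require Import all_classical all_reals all_analysis.
From mathcomp Require Import measurable_realfun ring lra.
Import Order.TTheory GRing.Theory Num.Theory.
Import numFieldNormedType.Exports.
Local Open Scope classical_set_scope.
Local Open Scope ring_scope.

(** Write [J = J_f], [m] for the mass and [M] for the matrix of second moments
of [f]. Testing the equation against the coordinate functions, whose spherical
gradient and Laplacian are explicit, gives
  [(|J|^2)' = 2 (a (m |J|^2 - J M J^T) - (n - 1) tau |J|^2)]
with [a = nu(|J|) / |J|]. As [a], [tau], [m] and [M] are bounded for [t] in a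
compact subset of [(0, +oo)], Gronwall's inequality shows that [J] never
vanishes. If [f] converged to the uniform distribution, the spherical harmonics
of degrees 0 and 2 would give [m --> rho] and [M --> (rho / n) Id], so for large
[t] the right-hand side would be [2 (n - 1) (a rho / n - tau) |J|^2 + o(|J|^2)].
For [rho > rho_c] it is nonnegative when [|J|] is small: [|J|] would be
eventually nondecreasing and positive, hence could not tend to 0. *)

Set Implicit Arguments.
Unset Strict Implicit.
Unset Printing Implicit Defensive.

(** The difference [g - f] vanishes near [x], so it is [o(h)] there and has differential 0. *)
Lemma near_eq_differentiable {R : realType} {V W : normedModType R}
    (f g : V -> W) x :
  (\forall y \near x, f y = g y) -> differentiable f x -> differentiable g x.
Proof.
move=> fg df; rewrite -[g](addrNK f) addrC.
apply: (differentiableD df); set k := g - f.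
have k0 : k x = 0 by rewrite -[LHS]/(g x - f x) (nbhs_singleton fg) subrr.
have kE : k \o shift x = cst (k x) + (0 : V -> W) +o_ 0 id.
  apply/eqaddoP => e e0; move: fg; rewrite (near_shift 0) subr0 => fg.
  near=> h.
  rewrite k0 -[X in `|X|]/(g (h + x) - f (h + x) - (0 + 0)).
  rewrite addr0 subr0 -(near fg h)// subrr normr0.
  by rewrite mulr_ge0// ltW.
have c0 : continuous (0 : V -> W) by move=> z; exact: cvg_cst.
have k'0 : 'd k x = (0 : V -> W) :> (V -> W) by exact: diff_unique.
by apply/diff_locallyP; split; rewrite k'0.
Unshelve. all: by end_near. Qed.

(** * Euclidean norm and its directional derivatives *)

Section euclidean.
Context {R : realType} {n : nat}.
Implicit Types (w x y v : 'rV[R]_n).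

Lemma dotp_ge0 x : 0 <= dotp x x.
Proof. by apply: sumr_ge0 => i _; rewrite -expr2 sqr_ge0. Qed.

Lemma dotp_eq0 x : (dotp x x == 0) = (x == 0).
Proof.
apply/idP/eqP => [|->]; last first.
  by apply/eqP/big1 => i _; rewrite mxE mul0r.
rewrite psumr_eq0 => [/allP x0|i _]; last by rewrite -expr2 sqr_ge0.
apply/rowP => i; rewrite mxE; apply/eqP.
by have := x0 i (mem_index_enum _); rewrite -expr2 sqrf_eq0.
Qed.

Lemma enorm_ge0 x : 0 <= enorm x.
Proof. exact: sqrtr_ge0. Qed.

Lemma sqr_enorm x : enorm x ^+ 2 = dotp x x.
Proof. by rewrite sqr_sqrtr// dotp_ge0. Qed.

Lemma enorm_eq0 x : (enorm x == 0) = (x == 0).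
Proof. by rewrite -dotp_eq0 -sqr_enorm sqrf_eq0. Qed.

Lemma sphere_dotp w : sphere R n w -> dotp w w = 1.
Proof. by move=> w1; rewrite -sqr_enorm w1 expr1n. Qed.

Lemma sphere_neq0 w : sphere R n w -> w != 0.
Proof. by move=> w1; rewrite -enorm_eq0 w1 oner_eq0. Qed.

Lemma dotpZ a x : dotp (a *: x) (a *: x) = a ^+ 2 * dotp x x.
Proof.
rewrite /dotp mulr_sumr; apply: eq_bigr => i _.
by rewrite !mxE; ring.
Qed.

Lemma sphere_normalize x : x != 0 -> sphere R n ((enorm x)^-1 *: x).
Proof.
move=> x0; have xn0 : enorm x != 0 by rewrite enorm_eq0.
rewrite /sphere /= {1}/enorm dotpZ -sqr_enorm -exprMn mulVf//.
by rewrite expr1n sqrtr1.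
Qed.

Lemma sqr_coord_le_dotp x i : (x ord0 i) ^+ 2 <= dotp x x.
Proof.
rewrite /dotp (bigD1 i)//= -expr2 lerDl.
by apply: sumr_ge0 => j _; rewrite -expr2 sqr_ge0.
Qed.

Lemma coord_le_enorm x i : `|x ord0 i| <= enorm x.
Proof. by rewrite -sqrtr_sqr ler_wsqrtr// sqr_coord_le_dotp. Qed.

Lemma dotp_basis_vec x i : dotp x (basis_vec i) = x ord0 i.
Proof.
rewrite /dotp (bigD1 i)//= big1 => [|j /negbTE ji]; last first.
  by rewrite mxE ji andbF mulr0.
by rewrite mxE !eqxx mulr1 addr0.
Qed.

Lemma differentiable_dotp x : differentiable (fun y => dotp y y) x.
Proof.
have -> : (fun y => dotp y y) = \sum_i ((fun y => y ord0 i) * (fun y => y ord0 i)).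
  by apply/funext => y; rewrite fct_sumE.
apply: differentiable_sum => i.
by apply: differentiableM; exact: differentiable_coord.
Qed.

Lemma differentiable_enorm x : x != 0 -> differentiable (@enorm R n) x.
Proof.
move=> x0; apply: (differentiable_comp (differentiable_dotp x)).
apply/derivable1_diffP.
have xx0 : 0 < dotp x x by rewrite lt0r dotp_eq0 x0 dotp_ge0.
by case: (is_derive1_sqrt xx0).
Qed.

Lemma near_neq0 w : w != 0 -> \forall x \near w, x != 0.
Proof.
move=> w0; exact: (cvgr_neq0 _ (@cvg_id _ (nbhs w)) w0).
Qed.

Lemma is_derive_coord x v i :
  is_derive x v (fun y : 'rV[R]_n => y ord0 i) (v ord0 i).
Proof.
have dx : differentiable (fun y : 'rV[R]_n => y ord0 i) x.
  exact: differentiable_coord.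
apply: DeriveDef; first exact: diff_derivable.
(* The coordinate is repackaged as a linear map, so that [diff_lin] makes it its own
   differential. *)
have @f : {linear 'rV[R]_n -> R}.
  by exists (fun N : 'rV[R]_n => N ord0 i); do 2![eexists]; do ?[constructor];
     rewrite ?mxE// => ? *; rewrite ?mxE//; move=> ?; rewrite !mxE.
rewrite deriveE// (_ : (fun _ => _) = f)// diff_lin//.
exact: coord_continuous.
Qed.

Lemma derive_dotp x v : 'D_v (fun y => dotp y y) x = 2 * dotp x v.
Proof.
have -> : (fun y => dotp y y) = \sum_i ((fun y => y ord0 i) * (fun y => y ord0 i)).
  by apply/funext => y; rewrite fct_sumE.
rewrite derive_sum => [|i]; last first.
  by apply: derivableM; apply: diff_derivable; exact: differentiable_coord.
rewrite /dotp mulr_sumr; apply: eq_bigr => i _.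
rewrite deriveM; [|by case: (is_derive_coord x v i)..].
rewrite (@derive_val _ _ _ _ _ _ _ (is_derive_coord x v i)).
by rewrite /GRing.scale/= mulr_natl mulr2n.
Qed.

(* Obtained by differentiating the identity [(enorm x)^-1 ^+ 2 * dotp x x = 1]. *)
Lemma derive_invr_enorm w v : sphere R n w ->
  'D_v (fun x => (enorm x)^-1) w = - dotp w v.
Proof.
move=> w1; have w0 := sphere_neq0 w1.
have dN : derivable (fun x => (enorm x)^-1) w v.
  apply: diff_derivable; apply: differentiableV; first exact: differentiable_enorm.
  by rewrite enorm_eq0.
have dq : derivable (fun y => dotp y y) w v.
  exact: diff_derivable (differentiable_dotp w).
have : 'D_v ((fun x => (enorm x)^-1) * (fun x => (enorm x)^-1)
    * (fun y => dotp y y)) w = 0.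
  rewrite -(derive_cst (1 : R) w v); apply: near_eq_derive.
  near=> x; have x0 : x != 0 by near: x; exact: near_neq0.
  rewrite /GRing.mul/= -sqr_enorm -expr2 -exprMn mulVf ?expr1n//.
  by rewrite enorm_eq0.
have product_rule (N q : 'rV[R]_n -> R) : derivable N w v -> derivable q w v ->
    'D_v (N * N * q) w = N w * N w * 'D_v q w + q w * (N w * 'D_v N w + N w * 'D_v N w).
  by move=> dN' dq'; rewrite (deriveM (derivableM dN' dN') dq') (deriveM dN' dN').
rewrite (product_rule _ _ dN dq) derive_dotp (sphere_dotp w1) w1 invr1.
move: ('D_v _ _) => d.
lra.
Unshelve. all: by end_near. Qed.

End euclidean.

(** * Polynomial functions on the sphere and their tangential derivatives *)

Section sphere_polynomials.
Context {R : realType} {n : nat}.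
Implicit Types (w x y v : 'rV[R]_n) (g h : 'rV[R]_n -> R).

Lemma ext0_sphere g w : sphere R n w -> ext0 g w = g w.
Proof. by move=> w1; rewrite /ext0 w1 invr1 scale1r. Qed.

(** Off the origin [ext0] samples values on the sphere only; a neighbourhood of [w] that avoids the
    origin is enough. *)
Lemma near_ext0_eq g h w : w != 0 -> (forall x, sphere R n x -> g x = h x) ->
  \forall x \near w, ext0 g x = ext0 h x.
Proof.
move=> w0 gh; near=> x; rewrite /ext0 gh//.
by apply: sphere_normalize; near: x; exact: near_neq0.
Unshelve. all: by end_near. Qed.

Lemma eq_sgrad g h w : sphere R n w -> (forall x, sphere R n x -> g x = h x) ->
  sgrad g w = sgrad h w.
Proof.
move=> w1 gh; apply/rowP => i; rewrite !mxE.
exact/near_eq_derive/near_ext0_eq/gh/sphere_neq0.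
Qed.

Lemma sgrad_cst (c : R) w i : sgrad (fun=> c) w ord0 i = 0.
Proof. by rewrite mxE (_ : ext0 _ = cst c)// derive_cst. Qed.

Lemma differentiable_ext0_coord w i : sphere R n w ->
  differentiable (ext0 (fun x => x ord0 i)) w.
Proof.
move=> w1; have w0 := sphere_neq0 w1.
have -> : ext0 (fun x : 'rV[R]_n => x ord0 i) =
    (fun x => (enorm x)^-1) * (fun x => x ord0 i).
  by apply/funext => x; rewrite /ext0 mxE.
apply: differentiableM; last exact: differentiable_coord.
apply: differentiableV; first exact: differentiable_enorm.
by rewrite enorm_eq0.
Qed.

(** The extension is [x_i / |x|]; the product rule with [derive_invr_enorm] yields the entries of
    [P_{w^perp}]. *)
Lemma sgrad_coord w i j : sphere R n w ->
  sgrad (fun x => x ord0 i) w ord0 j = (i == j)%:R - w ord0 i * w ord0 j.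
Proof.
move=> w1; have w0 := sphere_neq0 w1.
rewrite mxE.
have -> : ext0 (fun x : 'rV[R]_n => x ord0 i) =
    (fun x => (enorm x)^-1) * (fun x => x ord0 i).
  by apply/funext => x; rewrite /ext0 mxE.
rewrite deriveM; last 2 first.
- apply: diff_derivable; apply: differentiableV; first exact: differentiable_enorm.
  by rewrite enorm_eq0.
- by case: (is_derive_coord w (basis_vec j) i).
rewrite derive_invr_enorm// (@derive_val _ _ _ _ _ _ _ (is_derive_coord _ _ _)).
by rewrite /GRing.scale/= w1 invr1 dotp_basis_vec mxE eqxx/= mul1r mulrN.
Qed.

Lemma sgradD g h w i :
  differentiable (ext0 g) w -> differentiable (ext0 h) w ->
  sgrad (fun x => g x + h x) w ord0 i = sgrad g w ord0 i + sgrad h w ord0 i.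
Proof.
by move=> dg dh; rewrite !mxE -deriveD//; exact: diff_derivable.
Qed.

Lemma sgradM g h w i : sphere R n w ->
  differentiable (ext0 g) w -> differentiable (ext0 h) w ->
  sgrad (fun x => g x * h x) w ord0 i =
    sgrad g w ord0 i * h w + g w * sgrad h w ord0 i.
Proof.
move=> w1 dg dh; rewrite !mxE.
rewrite (_ : ext0 _ = ext0 g * ext0 h)// deriveM; [|exact: diff_derivable..].
by rewrite /GRing.scale/= !(ext0_sphere _ w1) addrC [X in X + _]mulrC.
Qed.

(* [SPeq] makes the class insensitive to the values off the sphere, which is
   what makes it stable under [sgrad]. *)
Inductive sphere_poly : ('rV[R]_n -> R) -> Prop :=
| SPcst c : sphere_poly (fun=> c)
| SPcoord i : sphere_poly (fun w => w ord0 i)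
| SPadd g h : sphere_poly g -> sphere_poly h -> sphere_poly (fun w => g w + h w)
| SPmul g h : sphere_poly g -> sphere_poly h -> sphere_poly (fun w => g w * h w)
| SPeq g h : (forall w, sphere R n w -> h w = g w) ->
    sphere_poly g -> sphere_poly h.

Lemma sphere_poly_differentiable g w : sphere R n w -> sphere_poly g ->
  differentiable (ext0 g) w.
Proof.
move=> w1; elim=> {g}.
- by move=> c; exact: differentiable_cst.
- by move=> i; exact: differentiable_ext0_coord.
- by move=> g h _ dg _ dh; exact: differentiableD dg dh.
- by move=> g h _ dg _ dh; exact: differentiableM dg dh.
- move=> g h gh _; apply: near_eq_differentiable.
  by apply: near_ext0_eq => [|x x1]; [exact: sphere_neq0|rewrite gh].
Qed.

(** Induction on the class: the gradient of a coordinate is again a polynomial, and the Leibniz rule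
    does the rest. These identities hold on the sphere only, which [SPeq] absorbs. *)
Lemma sphere_poly_sgrad g i : sphere_poly g ->
  sphere_poly (fun w => sgrad g w ord0 i).
Proof.
elim=> {g}.
- by move=> c; apply: (@SPeq (fun=> 0)) => [w _|]; [exact: sgrad_cst|exact: SPcst].
- move=> j; apply: (@SPeq (fun w => (j == i)%:R + (-1) * (w ord0 j * w ord0 i))).
    by move=> w w1; rewrite sgrad_coord// mulN1r.
  by do ![exact: SPcst|exact: SPcoord|apply: SPadd|apply: SPmul].
- move=> g h pg sg ph sh.
  apply: (@SPeq (fun w => sgrad g w ord0 i + sgrad h w ord0 i)); last exact: SPadd.
  by move=> w w1; apply: sgradD; exact: sphere_poly_differentiable.
- move=> g h pg sg ph sh.
  apply: (@SPeq (fun w => sgrad g w ord0 i * h w + g w * sgrad h w ord0 i)).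
    by move=> w w1; apply: sgradM => //; exact: sphere_poly_differentiable.
  by do ![by []|apply: SPadd|apply: SPmul].
- move=> g h gh pg sg; apply: (SPeq _ sg) => w w1.
  by rewrite (eq_sgrad w1 gh).
Qed.

Lemma sphere_poly_smooth g : sphere_poly g -> smooth_sphere g.
Proof.
move=> pg s w w1; apply: sphere_poly_differentiable => //.
by elim: s => //= i s; exact: sphere_poly_sgrad.
Qed.

Lemma sphere_poly_sum m (g : 'I_m -> 'rV[R]_n -> R) :
  (forall i, sphere_poly (g i)) -> sphere_poly (fun w => \sum_i g i w).
Proof.
elim: m g => [|m IH] g pg.
  by apply: (@SPeq (fun=> 0)) => [w _|]; [rewrite big_ord0|exact: SPcst].
apply: (@SPeq (fun w => g ord0 w + \sum_i g (lift ord0 i) w)).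
  by move=> w _; rewrite big_ord_recl.
by apply: SPadd => //; exact: IH.
Qed.

Lemma laplace_beltramiE g w :
  laplace_beltrami g w = \sum_i sgrad (fun x => sgrad g x ord0 i) w ord0 i.
Proof. by apply: eq_bigr => i _; rewrite [RHS]mxE. Qed.

End sphere_polynomials.

(** * Continuity, measurability and integrability on the sphere *)

Section sphere_integration.
Context {R : realType} {n : nat}.
Implicit Types (w x y : 'rV[R]_n) (g h : 'rV[R]_n -> R).

Lemma closed_sphere : closed (sphere R n).
Proof.
have enorm_cont : continuous (@enorm R n).
  move=> x; apply: continuous_comp.
    exact/differentiable_continuous/differentiable_dotp.
  exact: sqrt_continuous.
have -> : sphere R n = @enorm R n @^-1` [set 1] by [].
by apply: closed_comp; [move=> x _; exact: enorm_cont|exact: closed_eq].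
Qed.

Lemma norm_le_enorm x : `|x| <= enorm x.
Proof.
rewrite [leLHS]/Num.Def.normr /= mx_normrE; apply/bigmax_leP; split => [|[i j] _].
  exact: enorm_ge0.
by rewrite ord1; exact: coord_le_enorm.
Qed.

Lemma compact_sphere : compact (sphere R n).
Proof.
apply: bounded_closed_compact; last exact: closed_sphere.
exists 1; split; first exact: num_real.
by move=> M M1 w w1 /=; rewrite (le_trans (norm_le_enorm w))// w1 ltW.
Qed.

Lemma measurable_open (A : set 'rV[R]_n) : open A ->
  measurable (A : set (borel_rV R n)).
Proof. exact: sub_sigma_algebra. Qed.

Lemma measurable_sphere : measurable (sphere R n : set (borel_rV R n)).
Proof.
rewrite -[X in measurable X](setCK (sphere R n)).
apply: (@measurableC _ (borel_rV R n)); apply: measurable_open.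
exact/closed_openC/closed_sphere.
Qed.

Lemma continuous_measurable_borel_rV g : continuous g ->
  measurable_fun setT (g : borel_rV R n -> R).
Proof.
move=> cg; apply: (measurability _ (RGenOInfty.measurableE R)).
move=> _ [_ [a ->] <-]; rewrite setTI; apply: measurable_open.
by move/continuousP : cg; apply; exact: interval_open.
Qed.

(** Continuity is asked of the homogeneous extension, since the values of [g] off the sphere are
    arbitrary. *)
Definition sphere_continuous g :=
  forall w, sphere R n w -> {for w, continuous (ext0 g)}.

Lemma smooth_sphere_continuous g : smooth_sphere g -> sphere_continuous g.
Proof. by move=> sg w w1; exact: differentiable_continuous (sg [::] w w1). Qed.

Lemma continuous_sphere_continuous g : continuous g -> sphere_continuous g.
Proof.
move=> cg w w1; apply: continuous_comp; last exact: cg.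
have cV : {for w, continuous (fun x => (enorm x)^-1)}.
  apply: differentiable_continuous; have w0 := sphere_neq0 w1.
  apply: differentiableV; first exact: differentiable_enorm.
  by rewrite enorm_eq0.
exact: cvgZ cV (@cvg_id _ (nbhs w)).
Qed.

Lemma sphere_continuousM g h : sphere_continuous g -> sphere_continuous h ->
  sphere_continuous (fun x => g x * h x).
Proof. by move=> cg ch w w1; exact: cvgM (cg w w1) (ch w w1). Qed.

Lemma sphere_continuous_within g : sphere_continuous g ->
  {within sphere R n, continuous g}.
Proof.
move=> cg; have gE : {in sphere R n, ext0 g =1 g}.
  by move=> w; rewrite inE => w1; rewrite ext0_sphere.
apply: (subspace_eq_continuous gE).
by apply: continuous_in_subspaceT => w; rewrite inE; exact: cg.
Qed.

Lemma sphere_continuous_measurable g : sphere_continuous g ->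
  measurable_fun (sphere R n : set (borel_rV R n)) (g : borel_rV R n -> R).
Proof.
move=> cg; apply: (measurability _ (RGenOInfty.measurableE R)).
(* [ext0 g] is only known to be continuous at points of the sphere, so the preimage of the ray is
   replaced by its interior, which has the same trace on the sphere. *)
move=> _ [_ [a ->] <-]; set V := (ext0 g @^-1` `]a, +oo[)°.
have -> : sphere R n `&` g @^-1` `]a, +oo[ = sphere R n `&` V.
  apply/seteqP; split => w [w1 /=].
    rewrite -(ext0_sphere g w1) => gw; split => //.
    by apply: cg => //; exact: open_nbhs_nbhs.
  by move=> /interior_subset /=; rewrite ext0_sphere.
apply: measurableI; first exact: measurable_sphere.
by apply: measurable_open; exact: open_interior.
Qed.

Lemma sphere_continuous_bounded g : sphere_continuous g ->
  [bounded g x | x in sphere R n].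
Proof.
move=> /sphere_continuous_within cg.
have /compact_bounded := continuous_compact cg compact_sphere.
move=> [M [Mr gM]]; exists M; split => // x /gM h w w1 /=.
by apply: h; exists w.
Qed.

Lemma sphere_continuous_integrable (mu : {measure set (borel_rV R n) -> \bar R}) g :
  (mu (sphere R n) < +oo)%E -> sphere_continuous g ->
  mu.-integrable (sphere R n : set (borel_rV R n)) (EFin \o (g : borel_rV R n -> R)).
Proof.
move=> muoo cg; apply: measurable_bounded_integrable => //.
- exact: measurable_sphere.
- exact: sphere_continuous_measurable.
- exact: sphere_continuous_bounded.
Qed.

Lemma dist_density_cst (sigma : {measure set (borel_rV R n) -> \bar R}) (c : R) g :
  (sigma (sphere R n) < +oo)%E -> sphere_continuous g ->
  dist_density sigma (fun=> c) g = c * \int[sigma]_(w in sphere R n) g w.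
Proof.
move=> soo cg; rewrite /dist_density RintegralZl//; first exact: measurable_sphere.
exact: sphere_continuous_integrable.
Qed.

End sphere_integration.

(** * Functionals that are linear on polynomials *)

Section polynomial_functionals.
Context {R : realType} {n : nat}.
Implicit Types (T : sphere_distribution R n) (g h : 'rV[R]_n -> R).

(* A solution is determined, hence linear, on smooth test functions only. *)
Definition poly_linear T :=
  (forall c g h, sphere_poly g -> sphere_poly h ->
     T (fun w => c * g w + h w) = c * T g + T h) /\
  (forall g h, sphere_poly g -> (forall w, sphere R n w -> g w = h w) -> T g = T h).

Lemma poly_linear_density (sigma : {measure set (borel_rV R n) -> \bar R}) u :
  (sigma (sphere R n) < +oo)%E -> sphere_continuous u ->
  poly_linear (dist_density sigma u).
Proof.
move=> soo cu; split => [c g h pg ph|g h pg gh]; last first.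
  by apply: eq_Rintegral => w; rewrite inE => w1; rewrite gh.
have ci k : sphere_poly k ->
    sigma.-integrable (sphere R n : set (borel_rV R n))
      (EFin \o ((fun w => u w * k w) : borel_rV R n -> R)).
  move=> pk; apply: sphere_continuous_integrable => //.
  exact/(sphere_continuousM cu)/smooth_sphere_continuous/sphere_poly_smooth.
have mS := @measurable_sphere R n.
rewrite /dist_density -RintegralZl//; last exact: ci.
transitivity (\int[sigma]_(w in sphere R n) (u w * (c * g w) + u w * h w)).
  by apply: eq_Rintegral => w _; ring.
rewrite RintegralD//; [congr (_ + _)|apply: (ci (fun w => c * g w))|exact: ci].
  by apply: eq_Rintegral => w _; ring.
by apply: SPmul => //; exact: SPcst.
Qed.

Variable T : sphere_distribution R n.
Hypothesis linT : poly_linear T.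

Lemma poly_linear0 : T (fun=> 0) = 0.
Proof.
have [lT eT] := linT.
have := lT 1 _ _ (SPcst 0) (SPcst 0).
rewrite (eT _ (fun=> 0)); last 2 first.
- by do ![exact: SPcst|apply: SPadd|apply: SPmul].
- by move=> w _; ring.
lra.
Qed.

Lemma poly_linearZ c g : sphere_poly g -> T (fun w => c * g w) = c * T g.
Proof.
move=> pg; have [lT eT] := linT.
rewrite -[RHS]addr0 -poly_linear0 -lT//; last exact: SPcst.
apply: eT; last by move=> w _; ring.
by do ![exact: SPcst|by []|apply: SPadd|apply: SPmul].
Qed.

Lemma poly_linear_sum m (g : 'I_m -> 'rV[R]_n -> R) :
  (forall i, sphere_poly (g i)) -> T (fun w => \sum_i g i w) = \sum_i T (g i).
Proof.
have [lT eT] := linT.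
elim: m g => [|m IH] g pg.
  rewrite big_ord0; transitivity (T (fun=> 0)); last exact: poly_linear0.
  apply/esym/eT; first exact: SPcst.
  by move=> w _; rewrite big_ord0.
rewrite big_ord_recl -IH// -[X in X + _]mul1r -lT//; last exact: sphere_poly_sum.
apply: eT; first exact: sphere_poly_sum.
by move=> w _; rewrite big_ord_recl mul1r.
Qed.

End polynomial_functionals.

(** * Second moments of the uniform measure *)

Section uniform_moments.
Context {R : realType} {n : nat}.
Variable sigma : probability (borel_rV R n) R.
Hypothesis sigma_unif : uniform_sphere sigma.
Implicit Types (w : 'rV[R]_n) (g : 'rV[R]_n -> R) (U : 'M[R]_n).

Lemma sigma_sphere_lty : (sigma (sphere R n) < +oo)%E.
Proof. by rewrite sigma_unif.1 ltry. Qed.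

Lemma dotp_mulmx w U : U *m U^T = 1%:M -> dotp (w *m U) (w *m U) = dotp w w.
Proof.
move=> U1.
have dotpE x : dotp x x = (x *m x^T) ord0 ord0 :> R.
  by rewrite mxE; apply: eq_bigr => i _; rewrite mxE.
by rewrite !dotpE trmx_mul mulmxA -(mulmxA w) U1 mulmx1.
Qed.

Lemma continuous_mulmxr U : continuous (fun w => w *m U).
Proof.
move=> w.
have cU i j : {for w, continuous (fun x : 'rV[R]_n => (x *m U) i j)}.
  have -> : (fun x : 'rV[R]_n => (x *m U) i j) =
      \sum_k (fun x : 'rV[R]_n => x i k) * cst (U k j).
    by apply/funext => x; rewrite mxE fct_sumE.
  apply: differentiable_continuous; apply: differentiable_sum => k.
  by apply: differentiableM => //; exact: differentiable_coord.
(* A neighbourhood of a matrix contains a product of neighbourhoods of its entries, so continuity is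
   checked entry by entry. *)
move=> A [P nP PA].
have : \forall x \near w, forall i j, P i j ((x *m U) i j).
  near=> x; near: x; apply: filter_forall => i.
  near=> x; near: x; apply: filter_forall => j.
  by apply: cU; exact: nP.
by apply: filterS => x Px; exact: PA.
Unshelve. all: by end_near. Qed.

(** Change of variables: an orthogonal matrix preserves the sphere, and [sigma] is its own image
    measure. *)
Lemma Rintegral_sphere_invariant U g : U *m U^T = 1%:M -> continuous g ->
  \int[sigma]_(w in sphere R n) g (w *m U) = \int[sigma]_(w in sphere R n) g w.
Proof.
move=> U1 cg; set phi := (fun w : borel_rV R n => w *m U : borel_rV R n).
have mphi : measurable_fun setT phi.
  have mE : @measurable _ (borel_rV R n) = <<s @open 'rV[R]_n >> by [].
  apply: (measurability _ mE).
  move=> _ [B oB <-]; rewrite setTI; apply: measurable_open.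
  by move/continuousP : (@continuous_mulmxr U); apply.
have phiS : phi @^-1` sphere R n = sphere R n.
  by apply/seteqP; split => w; rewrite /sphere/= /enorm dotp_mulmx.
have cgU : sphere_continuous (fun w => g (w *m U)).
  apply: continuous_sphere_continuous => w.
  by apply: continuous_comp; [exact: continuous_mulmxr|exact: cg].
rewrite /Rintegral; congr fine.
have -> : (\int[sigma]_(w in sphere R n) (g w)%:E)%E =
    (\int[pushforward sigma phi]_(w in sphere R n) (g w)%:E)%E.
  apply: eq_measure_integral => A mA _.
  exact: esym (sigma_unif.2 U U1 A mA).
rewrite integral_pushforward ?phiS//.
- by apply/measurable_EFinP; exact: continuous_measurable_borel_rV.
- exact: (sphere_continuous_integrable sigma_sphere_lty cgU).
- exact: measurable_sphere.
Qed.

Lemma int_sphere1 : \int[sigma]_(w in sphere R n) 1 = 1 :> R.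
Proof.
have mS := @measurable_sphere R n.
by rewrite Rintegral_cst// mul1r; exact: (congr1 fine sigma_unif.1).
Qed.

Lemma continuous_coord2 i j : continuous (fun w => w ord0 i * w ord0 j).
Proof.
move=> w; exact: cvgM (@coord_continuous _ _ _ ord0 i w)
  (@coord_continuous _ _ _ ord0 j w).
Qed.

(** The reflection that flips the sign of coordinate [i] turns the integral into its opposite. *)
Lemma int_coord2_neq i j : i != j ->
  \int[sigma]_(w in sphere R n) (w ord0 i * w ord0 j) = 0.
Proof.
move=> ij.
pose U : 'M[R]_n := diag_mx (\row_k (if k == i then -1 else 1)).
have U1 : U *m U^T = 1%:M.
  rewrite tr_diag_mx mulmx_diag -diag_const_mx; congr diag_mx.
  by apply/rowP => k; rewrite !mxE; case: ifP => _; rewrite ?mulrNN mulr1.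
have UE w k : (w *m U) ord0 k = w ord0 k * (if k == i then -1 else 1).
  by rewrite mul_mx_diag !mxE.
have := Rintegral_sphere_invariant U1 (@continuous_coord2 i j).
under eq_Rintegral do rewrite !UE eqxx eq_sym (negbTE ij) mulr1 mulrN1 mulNr.
under eq_Rintegral do rewrite -mulN1r.
rewrite RintegralZl; [lra|exact: measurable_sphere|].
apply: (sphere_continuous_integrable sigma_sphere_lty).
apply/smooth_sphere_continuous/sphere_poly_smooth.
by apply: SPmul; exact: SPcoord.
Qed.

(** Invariance under the permutation matrix that exchanges coordinates [i] and [j]. *)
Lemma int_coord2_eq i j :
  \int[sigma]_(w in sphere R n) (w ord0 i * w ord0 i) =
  \int[sigma]_(w in sphere R n) (w ord0 j * w ord0 j).
Proof.
have := @Rintegral_sphere_invariant (perm_mx (tperm i j)) _ _ (@continuous_coord2 i i).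
rewrite tr_perm_mx -perm_mxM mulgV perm_mx1 => /(_ erefl) <-.
apply: eq_Rintegral => w _.
by rewrite -(tpermV i j) -col_permE !mxE tpermL.
Qed.

(** On the diagonal, the [n] integrals are equal and add up to the integral of [dotp w w = 1]. *)
Lemma int_coord2 i j : \int[sigma]_(w in sphere R n) (w ord0 i * w ord0 j) =
  (i == j)%:R / n%:R.
Proof.
have [<-|ij] := eqVneq i j; last by rewrite mul0r int_coord2_neq.
have n0 : n%:R != 0 :> R by rewrite pnatr_eq0; case: (n) i => [[]|].
apply: (mulfI n0); rewrite mul1r mulfV//.
transitivity (\int[sigma]_(w in sphere R n) (1 : R)); last exact: int_sphere1.
have := @poly_linear_density _ _ sigma (fun=> 1) sigma_sphere_lty
  (smooth_sphere_continuous (sphere_poly_smooth (SPcst 1))).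
move=> lin.
have dE g : dist_density sigma (fun=> 1) g = \int[sigma]_(w in sphere R n) g w.
  by apply: eq_Rintegral => w _; rewrite mul1r.
transitivity (\sum_(j < n) dist_density sigma (fun=> 1) (fun w => w ord0 j * w ord0 j)).
  rewrite (eq_bigr (fun=> \int[sigma]_(w in sphere R n) (w ord0 i * w ord0 i))).
    by rewrite sumr_const card_ord mulr_natl.
  by move=> k _; rewrite dE; exact: int_coord2_eq.
rewrite -poly_linear_sum// => [|k]; last by apply: SPmul; exact: SPcoord.
by rewrite dE; apply: eq_Rintegral => w; rewrite inE => /sphere_dotp.
Qed.

End uniform_moments.

(** * Laplacian of polynomials; spherical harmonics of degrees 0 and 2 *)

Section sphere_laplacian.
Context {R : realType} {n : nat}.
Implicit Types (w x y v : 'rV[R]_n) (g h : 'rV[R]_n -> R).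

Lemma sphere_poly_laplace g : sphere_poly g -> sphere_poly (laplace_beltrami g).
Proof.
move=> pg; apply: (@SPeq _ _ (fun w => \sum_i sgrad (fun x => sgrad g x ord0 i) w ord0 i)).
  by move=> w _; exact: laplace_beltramiE.
by apply: sphere_poly_sum => i; do 2 apply: sphere_poly_sgrad.
Qed.

Lemma sphere_polyB g h : sphere_poly g -> sphere_poly h ->
  sphere_poly (fun w => g w - h w).
Proof.
move=> pg ph; apply: (@SPeq _ _ (fun w => g w + (-1) * h w)).
  by move=> w _; rewrite mulN1r.
by do ![exact: SPcst|by []|apply: SPadd|apply: SPmul].
Qed.

(** Leibniz rule for [sgrad] applied twice in each direction; the cross terms add up to the product
    of the gradients. *)
Lemma laplaceM g h w : sphere R n w -> sphere_poly g -> sphere_poly h ->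
  laplace_beltrami (fun x => g x * h x) w =
  laplace_beltrami g w * h w + g w * laplace_beltrami h w
  + 2 * dotp (sgrad g w) (sgrad h w).
Proof.
move=> w1 pg ph; rewrite !laplace_beltramiE mulr_suml !mulr_sumr -!big_split/=.
apply: eq_bigr => i _.
have dg := sphere_poly_differentiable w1 pg.
have dh := sphere_poly_differentiable w1 ph.
have pg' := sphere_poly_sgrad i pg; have ph' := sphere_poly_sgrad i ph.
have dg' := sphere_poly_differentiable w1 pg'.
have dh' := sphere_poly_differentiable w1 ph'.
have e x : sphere R n x -> sgrad (fun x => g x * h x) x ord0 i =
    sgrad g x ord0 i * h x + g x * sgrad h x ord0 i.
  by move=> x1; apply: sgradM => //; exact: sphere_poly_differentiable.
rewrite (eq_sgrad w1 e) sgradD; last 2 first.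
- by apply: sphere_poly_differentiable => //; exact: SPmul.
- by apply: sphere_poly_differentiable => //; exact: SPmul.
rewrite (@sgradM _ _ (fun x => sgrad g x ord0 i) h w i)//.
rewrite (@sgradM _ _ g (fun x => sgrad h x ord0 i) w i)//.
have leibniz (a b c d l k : R) :
  a * k + b * l + (b * l + c * d) = a * k + c * d + 2 * (b * l) by ring.
exact: leibniz.
Qed.

Lemma laplaceB_cst g (c : R) w : sphere R n w -> sphere_poly g ->
  laplace_beltrami (fun x => g x - c) w = laplace_beltrami g w.
Proof.
move=> w1 pg; rewrite !laplace_beltramiE; apply: eq_bigr => i _.
have e x : sphere R n x -> sgrad (fun x => g x - c) x ord0 i = sgrad g x ord0 i.
  move=> x1; rewrite (@sgradD _ _ g (fun=> - c)).
  - by rewrite sgrad_cst addr0.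
  - exact: sphere_poly_differentiable.
  - by apply: sphere_poly_differentiable => //; exact: SPcst.
by rewrite (eq_sgrad w1 e).
Qed.

Lemma sumr_delta (F : 'I_n -> R) i : \sum_k (i == k)%:R * F k = F i.
Proof.
rewrite (bigD1 i)//= eqxx mul1r big1 ?addr0// => k /negbTE ki.
by rewrite eq_sym ki mul0r.
Qed.

(** The gradients of the coordinates are the rows of the symmetric projection [P = P_{w^perp}], and
    [P P^T = P]. *)
Lemma dotp_sgrad_coord w i j : sphere R n w ->
  dotp (sgrad (fun x => x ord0 i) w) (sgrad (fun x => x ord0 j) w) =
  (i == j)%:R - w ord0 i * w ord0 j.
Proof.
move=> w1; rewrite /dotp.
transitivity (\sum_k ((i == k)%:R * (j == k)%:R
    + (i == k)%:R * (- (w ord0 j * w ord0 k)) + (j == k)%:R * (- (w ord0 i * w ord0 k))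
    + w ord0 i * w ord0 j * (w ord0 k * w ord0 k))).
  by apply: eq_bigr => k _; rewrite !sgrad_coord//; ring.
rewrite !big_split/= !sumr_delta -mulr_sumr.
rewrite -/(dotp w w) sphere_dotp//.
by rewrite eq_sym; ring.
Qed.

(** Coordinates are harmonics of degree 1, with eigenvalue [n - 1]: the three sums below are
    [- w_i], [- n w_i] and [2 w_i]. *)
Lemma laplace_coord w i : sphere R n w ->
  laplace_beltrami (fun x => x ord0 i) w = - (n%:R - 1) * w ord0 i.
Proof.
move=> w1; rewrite laplace_beltramiE.
have pc j : sphere_poly (fun x : 'rV[R]_n => x ord0 j) by exact: SPcoord.
have dc j := sphere_poly_differentiable w1 (pc j).
have e k x : sphere R n x -> sgrad (fun x => x ord0 i) x ord0 k =
    (i == k)%:R + (-1) * (x ord0 i * x ord0 k).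
  by move=> x1; rewrite sgrad_coord// mulN1r.
transitivity (\sum_k ((i == k)%:R * (- w ord0 k) + (- w ord0 i)
   + (2 * w ord0 i) * (w ord0 k * w ord0 k))).
  apply: eq_bigr => k _; rewrite (eq_sgrad w1 (e k)).
  have dcst c := sphere_poly_differentiable w1 (SPcst c).
  have dm := sphere_poly_differentiable w1 (SPmul (pc i) (pc k)).
  have dcm := sphere_poly_differentiable w1 (SPmul (SPcst (-1)) (SPmul (pc i) (pc k))).
  rewrite sgradD// sgrad_cst sgradM//.
  by rewrite sgrad_cst sgradM// !sgrad_coord// eqxx -[true%:R]/(1 : R); ring.
rewrite !big_split/= sumr_delta -mulr_sumr sumr_const card_ord.
rewrite -/(dotp w w) sphere_dotp//.
by rewrite -[X in _ + X + _]mulr_natl; ring.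
Qed.

(** On the sphere these are the entries of the trace-free part of [w^T *m w]. *)
Definition quadratic_harmonic (i j : 'I_n) w : R :=
  w ord0 i * w ord0 j - (i == j)%:R / n%:R.

Lemma sphere_poly_quadratic i j : sphere_poly (quadratic_harmonic i j).
Proof. by do ![exact: SPcst|exact: SPcoord|apply: sphere_polyB|apply: SPmul]. Qed.

(** The product formula gives [-2 (n - 1) w_i w_j + 2 ((i == j) - w_i w_j)], which is [-2 n] times
    the function, and the eigenvalue of degree 2 is [2 n]. *)
Lemma spherical_harmonic_quadratic i j : spherical_harmonic 2 (quadratic_harmonic i j).
Proof.
split; first exact/sphere_poly_smooth/sphere_poly_quadratic.
move=> w w1; have n0 : n%:R != 0 :> R by rewrite pnatr_eq0; case: (n) i => [[]|].
rewrite laplaceB_cst//; last by apply: SPmul; exact: SPcoord.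
rewrite laplaceM//; [|exact: SPcoord..].
rewrite !laplace_coord// dotp_sgrad_coord// /sphere_eigenvalue /quadratic_harmonic.
by field.
Qed.

Lemma spherical_harmonic_cst (c : R) : @spherical_harmonic R n 0 (fun=> c).
Proof.
split; first exact/sphere_poly_smooth/SPcst.
move=> w w1; rewrite /sphere_eigenvalue mul0r oppr0 mul0r laplace_beltramiE.
by apply: big1 => i _; rewrite (eq_sgrad w1 (h := fun=> 0)) ?sgrad_cst// => x _;
  exact: sgrad_cst.
Qed.

Lemma spherical_harmonic0 l : @spherical_harmonic R n l (fun=> 0).
Proof.
have [s h] := spherical_harmonic_cst 0; split => // w w1.
by rewrite h// !mulr0.
Qed.

(** Provides the normalisation that [harmonic_energy] requires of its test functions. *)
Lemma quadratic_harmonic_le1 i j w : sphere R n w -> (quadratic_harmonic i j w) ^+ 2 <= 1.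
Proof.
move=> w1; have n1 : 1 <= n%:R :> R by rewrite ler1n; case: (n) i => [[]|].
have c1 k : `|w ord0 k| <= 1 by rewrite -w1 coord_le_enorm.
rewrite -real_normK ?num_real// expr_le1//.
rewrite /quadratic_harmonic; have [<-|ij] := eqVneq i j; last first.
  by rewrite mul0r subr0 normrM mulr_ile1.
have i1 : 0 <= w ord0 i * w ord0 i <= 1.
  by rewrite -expr2 sqr_ge0/= -real_normK ?num_real// expr_le1 ?c1.
have n0 : 0 <= 1 / n%:R :> R by rewrite div1r invr_ge0 ler0n.
have nV1 : 1 / n%:R <= 1 :> R by rewrite div1r invf_le1// (lt_le_trans _ n1).
rewrite ler_norml -[true%:R]/(1 : R); lra.
Qed.

End sphere_laplacian.

(** * From Sobolev convergence to convergence of moments *)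

Section sobolev_moments.
Context {R : realType} {n : nat}.
Variable sigma : probability (borel_rV R n) R.
Hypothesis sigma_unif : uniform_sphere sigma.
Implicit Types (T : sphere_distribution R n) (Y : 'rV[R]_n -> R).

Lemma harmonic_energy_ge l T Y : spherical_harmonic l Y ->
  \int[sigma]_(w in sphere R n) (Y w ^+ 2) <= 1 ->
  (((T Y) ^+ 2)%:E <= harmonic_energy sigma l T)%E.
Proof. by move=> hY Y1; apply: ereal_sup_ubound; exists Y. Qed.

(** The zero function competes in every degree, so the supremum is at least a square. *)
Lemma harmonic_energy_ge0 l T : (0 <= harmonic_energy sigma l T)%E.
Proof.
apply: (@le_trans _ _ ((T (fun=> 0)) ^+ 2)%:E); first by rewrite lee_fin sqr_ge0.
apply: harmonic_energy_ge; first exact: spherical_harmonic0.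
rewrite (@eq_Rintegral _ _ _ _ _ (fun=> 0)); last by move=> w _; rewrite expr0n.
by rewrite Rintegral_cst ?mul0r//; exact: measurable_sphere.
Qed.

(** At order 0 every weight is 1 and the energies are nonnegative, so the series dominates its term
    of index [l], hence [(T Y)^2]. The pointwise bound on [Y] gives its normalisation because
    [sigma] has mass 1. *)
Lemma sobolev_norm_ge l T Y : spherical_harmonic l Y ->
  (forall w, sphere R n w -> Y w ^+ 2 <= 1) ->
  (`|T Y|%:E <= sobolev_norm sigma 0 T)%E.
Proof.
move=> hY Y1.
have intY : \int[sigma]_(w in sphere R n) (Y w ^+ 2) <= 1.
  have cY := smooth_sphere_continuous hY.1.
  have soo := sigma_sphere_lty sigma_unif.
  rewrite -[leRHS](int_sphere1 sigma_unif); apply: le_Rintegral => //.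
  - exact: measurable_sphere.
  - exact: (sphere_continuous_integrable soo (sphere_continuousM cY cY)).
  - apply: (sphere_continuous_integrable soo).
    exact/smooth_sphere_continuous/sphere_poly_smooth/SPcst.
rewrite -sqrtr_sqr -powR12_sqrt ?sqr_ge0// -poweR_EFin.
have TY0 : (0 <= ((T Y) ^+ 2)%:E)%E by rewrite lee_fin sqr_ge0.
rewrite /sobolev_norm; set S := (\sum_(0 <= l <oo) _)%E.
suff TYS : (((T Y) ^+ 2)%:E <= S)%E.
  apply: gt0_ler_poweR => //; rewrite in_itv/= leey andbT//.
  exact: le_trans TYS.
have e0 k : ((1 + sphere_eigenvalue (n := n) k) `^ 0)%:E = 1%E :> \bar R by rewrite powRr0.
apply: (@le_trans _ _ (\sum_(0 <= k < l.+1)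
    ((1 + sphere_eigenvalue (n := n) k) `^ 0)%:E * harmonic_energy sigma k T)%E).
  rewrite big_nat_recr//= e0 mul1e.
  apply: le_trans (harmonic_energy_ge T hY intY) _.
  rewrite leeDr//; apply: sume_ge0 => k _.
  by rewrite e0 mul1e harmonic_energy_ge0.
by apply: nneseries_lim_ge => k _ _; rewrite e0 mul1e harmonic_energy_ge0.
Qed.

Variables (F : R -> sphere_distribution R n) (rho : R).
Hypothesis linF : forall t : R, 0 < t -> poly_linear (F t).
Hypothesis cvgF : sobolev_norm sigma 0 (F t \- dist_density sigma (cst rho))
   @[t --> +oo] --> (0%E : \bar R).

(** [sobolev_norm_ge] is applied to the difference between [F t] and the uniform density. *)
Lemma sobolev_cvg_harmonic l Y : sphere_poly Y -> spherical_harmonic l Y ->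
  (forall w, sphere R n w -> Y w ^+ 2 <= 1) ->
  F t Y @[t --> +oo] --> rho * \int[sigma]_(w in sphere R n) Y w.
Proof.
move=> pY hY Y1; apply/cvgrPdist_lt => e e0.
have soo := sigma_sphere_lty sigma_unif.
have small : \forall t \near +oo, (sobolev_norm sigma 0
    (F t \- dist_density sigma (cst rho))%R < e%:E)%E.
  have e0' : (0 < e%:E)%E by rewrite lte_fin.
  exact: cvgF (open_ereal_lt' e0').
near=> t; rewrite distrC.
rewrite -(dist_density_cst rho soo); last exact: (smooth_sphere_continuous hY.1).
rewrite -lte_fin; apply: le_lt_trans
  (sobolev_norm_ge (F t \- dist_density sigma (cst rho)) hY Y1) _.
by near: t.
Unshelve. all: by end_near. Qed.

Lemma sobolev_cvg_mass : F t (fun=> 1) @[t --> +oo] --> rho.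
Proof.
have := @sobolev_cvg_harmonic 0 (fun=> 1) (SPcst 1) (spherical_harmonic_cst 1).
by rewrite int_sphere1// mulr1; apply => w _; rewrite expr1n.
Qed.

(** [w_i w_j] is a harmonic of degree 2, of integral 0, plus the constant [(i == j) / n], which is
    tested by the mass. *)
Lemma sobolev_cvg_coord2 i j : F t (fun w => w ord0 i * w ord0 j) @[t --> +oo] -->
  (i == j)%:R * (rho / n%:R).
Proof.
have pY := @sphere_poly_quadratic R n i j.
have soo := sigma_sphere_lty sigma_unif.
have pc2 : sphere_poly (fun w : 'rV[R]_n => w ord0 i * w ord0 j).
  by apply: SPmul; exact: SPcoord.
have Y0 : \int[sigma]_(w in sphere R n) quadratic_harmonic i j w = 0.
  have mS := @measurable_sphere R n.
  rewrite RintegralB//; last 2 first.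
  - exact/(sphere_continuous_integrable soo)/smooth_sphere_continuous/sphere_poly_smooth.
  - apply: (sphere_continuous_integrable soo).
    exact/smooth_sphere_continuous/sphere_poly_smooth/SPcst.
  rewrite int_coord2// Rintegral_cst// (_ : fine _ = 1) ?mulr1 ?subrr//.
  exact: (congr1 fine sigma_unif.1).
have := sobolev_cvg_harmonic pY (spherical_harmonic_quadratic i j)
  (@quadratic_harmonic_le1 R n i j).
rewrite Y0 mulr0 => cY.
have c1 : (i == j)%:R / n%:R * F t (fun=> 1) @[t --> +oo] -->
    (i == j)%:R / n%:R * rho.
  exact: cvgMr sobolev_cvg_mass.
rewrite -[X in _ --> X]add0r mulrCA [_ * (_ / _)]mulrC.
apply: cvg_trans (cvgD cY c1); apply: near_eq_cvg; near=> t.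
have t0 : 0 < t by near: t; exact: nbhs_pinfty_gt.
have [lT eT] := linF t0.
rewrite -[LHS]/(F t (quadratic_harmonic i j) + (i == j)%:R / n%:R * F t (fun=> 1)).
rewrite addrC -lT//; last exact: SPcst.
apply: eT => [|w _]; last by rewrite /quadratic_harmonic; ring.
by apply: SPadd => //; apply: SPmul; exact: SPcst.
Unshelve. all: by end_near. Qed.

End sobolev_moments.

(** * The collision operator tested against coordinates *)

Section moment_equation.
Context {R : realType} {n : nat}.
Variables (nu tau : R -> R) (T : sphere_distribution R n).
Hypothesis linT : poly_linear T.

Lemma mul_proj_perp (x w : 'rV[R]_n) k :
  (x *m proj_perp w) ord0 k = x ord0 k - dotp x w * w ord0 k.
Proof.
rewrite /proj_perp mulmxBr mulmx1 mulmxA !mxE big_ord1; congr (_ - _ * _).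
by rewrite mxE; apply: eq_bigr => j _; rewrite mxE.
Qed.

Lemma dist_laplace_coord i :
  dist_laplace T (fun w => w ord0 i) = - (n%:R - 1) * momentum T ord0 i.
Proof.
have [lT eT] := linT; rewrite mxE -poly_linearZ//; last exact: SPcoord.
apply: eT; first exact/sphere_poly_laplace/SPcoord.
by move=> w; exact: laplace_coord.
Qed.

(** By duality the integrand is the product of [P_{w^perp} x] with [P_{w^perp} e_i], that is
    [x_i - (x . w) w_i]: only the mass and the second moments appear. *)
Lemma dist_div_coord (x : 'rV[R]_n) i :
  - dist_div (dist_field (fun w => x *m proj_perp w) T) (fun w => w ord0 i) =
  x ord0 i * T (fun=> 1) - \sum_j x ord0 j * T (fun w => w ord0 i * w ord0 j).
Proof.
have [lT eT] := linT.
have pc j : sphere_poly (fun w : 'rV[R]_n => w ord0 j) by exact: SPcoord.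
have pcc j : sphere_poly (fun w : 'rV[R]_n => w ord0 i * w ord0 j) by exact: SPmul.
have pxcc j : sphere_poly (fun w : 'rV[R]_n => x ord0 j * (w ord0 i * w ord0 j)).
  by apply: SPmul => //; exact: SPcst.
have pdot : sphere_poly (fun w => dotp x w).
  by apply: sphere_poly_sum => j; apply: SPmul => //; exact: SPcst.
rewrite /dist_div opprK /dist_field -poly_linear_sum//; last first.
  move=> k; apply: SPmul; last exact: sphere_poly_sgrad.
  apply: (@SPeq _ _ (fun w => x ord0 k - dotp x w * w ord0 k)).
    by move=> w _; exact: mul_proj_perp.
  by apply: sphere_polyB; [exact: SPcst|exact: SPmul].
transitivity (T (fun w => - 1 * (\sum_j x ord0 j * (w ord0 i * w ord0 j)) + x ord0 i * 1)).
  apply/esym/eT.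
    apply: SPadd; apply: SPmul; [exact: SPcst|exact: sphere_poly_sum|exact: SPcst..].
  move=> w w1; under [RHS]eq_bigr do rewrite mul_proj_perp sgrad_coord//.
  (* The last two sums cancel, as [P_{w^perp} x] is orthogonal to [w]. *)
  transitivity (\sum_k ((i == k)%:R * (x ord0 k - dotp x w * w ord0 k)
      + (- w ord0 i) * (x ord0 k * w ord0 k)
      + w ord0 i * dotp x w * (w ord0 k * w ord0 k))).
    rewrite !big_split/= sumr_delta -!mulr_sumr -!/(dotp _ _) sphere_dotp//.
    rewrite (eq_bigr (fun j => w ord0 i * (x ord0 j * w ord0 j)));
      last by move=> j _; ring.
    by rewrite -mulr_sumr -/(dotp _ _); ring.
  by apply: eq_bigr => k _; ring.
rewrite lT; last 2 first.
- exact: sphere_poly_sum.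
- by apply: SPmul; exact: SPcst.
rewrite poly_linearZ//; last exact: SPcst.
rewrite poly_linear_sum// mulN1r addrC; congr (_ - _).
by apply: eq_bigr => j _; rewrite poly_linearZ.
Qed.

(* The junk values [nu 0 / 0 = 0] make the formula valid also when the
   momentum vanishes. *)
Lemma Qop_coord i : let J := momentum T in let r := enorm J in
  Qop nu tau T (fun w => w ord0 i) =
  nu r / r * (J ord0 i * T (fun=> 1)
    - \sum_j J ord0 j * T (fun w => w ord0 i * w ord0 j))
  - (n%:R - 1) * tau r * J ord0 i.
Proof.
move=> J r; rewrite /Qop -/J -/r.
have [J0|J0] := eqVneq J 0; rewrite dist_laplace_coord -/J.
  have -> : r = 0 by apply/eqP; rewrite enorm_eq0 J0.
  by rewrite J0 mxE invr0; ring.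
rewrite [- nu _ * _]mulNr -[- (nu _ * _)]mulrN dist_div_coord /direction -/J -/r mxE.
under eq_bigr do rewrite mxE -mulrA.
rewrite -mulr_sumr; ring.
Qed.

End moment_equation.

(** * Coefficients near zero momentum and the critical density *)

Section critical_density.
Context {R : realType}.

Lemma lipschitz_dist (g : R -> R) (A : set R) : [lipschitz g r | r in A] ->
  exists2 K : R, 0 < K & forall x y, A x -> A y -> `|g x - g y| <= K * `|x - y|.
Proof.
move=> [K0 [_ lipK]]; exists (`|K0| + 1); first by rewrite ltr_wpDl.
by move=> x y Ax Ay; apply: (lipK _ _ (x, y)) => //; rewrite ltr_pwDr// ler_norm.
Qed.

(** Meant for [nu r / r], whose value at 0 is the default 0 and need not be the limit; the limit
    comes from the Cauchy criterion. *)
Lemma lipschitz_is_cvg_at_right (g : R -> R) (a : R) (A : set R) :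
  `]a, +oo[ `<=` A -> [lipschitz g r | r in A] -> cvg (g r @[r --> a^'+]).
Proof.
move=> aA /lipschitz_dist[K K_gt0 lipK].
apply/cauchy_cvgP/cauchyP => e e0; pose d := e / K.
have d0 : 0 < d by rewrite divr_gt0.
exists (g (a + d / 2)).
suff : \forall r \near a^'+, `|g (a + d / 2) - g r| < e by [].
near=> r.
have ra : a < r by near: r; exact: nbhs_right_gt.
have rd : r < a + d / 2 by near: r; apply: nbhs_right_lt; lra.
apply: le_lt_trans (lipK _ _ _ _) _; [apply: aA; rewrite /= in_itv/= andbT; lra..|].
by rewrite mulrC -ltr_pdivlMr// ger0_norm -/d; lra.
Unshelve. all: by end_near. Qed.

Lemma lipschitz_cvg_at_right (g : R -> R) (a : R) (A : set R) :
  `[a, +oo[ `<=` A -> [lipschitz g r | r in A] -> g r @[r --> a^'+] --> g a.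
Proof.
move=> aA /lipschitz_dist[K K_gt0 lipK].
apply/cvgrPdist_lt => e e0; near=> r.
have ra : a < r by near: r; exact: nbhs_right_gt.
have re : r < a + e / K by near: r; apply: nbhs_right_lt; rewrite ltrDl divr_gt0.
apply: le_lt_trans (lipK _ _ _ _) _; [apply: aA; rewrite /= in_itv/= andbT; lra..|].
by rewrite mulrC -ltr_pdivlMr// ler0_norm; lra.
Unshelve. all: by end_near. Qed.

Variables (n : nat) (nu tau : R -> R) (rho : R).
Hypothesis n_gt0 : (0 < n)%N.
Hypothesis nu_ge0 : forall r : R, 0 <= r -> 0 <= nu r.
Hypothesis tau_gt0 : forall r : R, 0 <= r -> 0 < tau r.
Hypothesis nu_lip : [lipschitz nu r / r | r in [set r : R | 0 < r]].
Hypothesis tau_lip : [lipschitz tau r | r in [set r : R | 0 <= r]].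
Hypothesis k_incr : forall r s : R, 0 <= r -> r < s -> kfun nu tau r < kfun nu tau s.
Hypothesis rho_gt : (critical_density n (kfun nu tau) < rho%:E)%E.

(* The growth rate of a small momentum around the uniform distribution of mass
   [rho] is [(n - 1) * (rho / n * (nu r / r) - tau r)]. *)
Lemma supercritical_growth : exists2 kappa : R, 0 < kappa &
  \forall r \near 0^'+, kappa <= rho / n%:R * (nu r / r) - tau r.
Proof.
have n0 : 0 < n%:R :> R by rewrite ltr0n.
have cb : cvg (nu r / r @[r --> 0^'+]).
  by apply: lipschitz_is_cvg_at_right nu_lip => r /=; rewrite in_itv/= andbT.
have ctau : tau r @[r --> 0^'+] --> tau 0.
  by apply: lipschitz_cvg_at_right tau_lip => r /=; rewrite in_itv/= andbT.
set a0 := lim (nu r / r @[r --> 0^'+]) in cb *.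
(* [q] is the inverse of the quotient [n r / k(r)] that defines the critical density; unlike that
   quotient, it always has a finite limit at 0. *)
pose q r := nu r / r / (n%:R * tau r).
have nt0 : 0 < n%:R * tau 0 by rewrite mulr_gt0// tau_gt0.
have cq : q r @[r --> 0^'+] --> a0 / (n%:R * tau 0).
  apply: cvgM => //; apply: cvgV; first by rewrite gt_eqF.
  exact: cvgMr.
(* [k] is strictly increasing and [k 0] is nonnegative. *)
have nu_gt0 r : 0 < r -> 0 < nu r.
  move=> r0; have := k_incr (lexx 0) r0.
  rewrite /kfun ltr_pdivlMr ?tau_gt0 1?ltW//; apply: le_lt_trans.
  by rewrite mulr_ge0// ?divr_ge0// ?nu_ge0// ltW// tau_gt0// ltW.
have tau_pos r : 0 < r -> 0 < tau r by move=> r0; exact/tau_gt0/ltW.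
have q_gt0 r : 0 < r -> 0 < q r.
  by move=> r0; rewrite /q !divr_gt0 ?mulr_gt0 ?tau_pos ?nu_gt0.
have qE : \forall r \near 0^'+, (q r)^-1 = n%:R * r / kfun nu tau r.
  near=> r; have r0 : 0 < r by near: r; exact: nbhs_right_gt.
  rewrite /q /kfun; field.
  by rewrite !gt_eqF ?nu_gt0 ?tau_pos.
have a0_ge0 : 0 <= a0 / (n%:R * tau 0).
  apply: (cvgr_to_ge cq); near=> r; apply/ltW/q_gt0.
  by near: r; exact: nbhs_right_gt.
(* If the limit were 0, [n r / k(r)] would tend to [+oo] and the critical density would be infinite,
   against [rho_gt]. *)
have q0 : 0 < a0 / (n%:R * tau 0).
  rewrite lt_neqAle a0_ge0 andbT eq_sym; apply/eqP => q00.
  rewrite q00 in cq.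
  have : (fun r => (q r)^-1) @ 0^'+ --> +oo.
    apply/cvgrVy => //; near=> r; apply: q_gt0.
    by near: r; exact: nbhs_right_gt.
  move/cvgeryP => cy; move: rho_gt.
  rewrite /critical_density (_ : lim _ = +oo%E)//.
  apply: cvg_lim => //; apply: cvg_trans cy; apply: near_eq_cvg.
  by near=> r; congr (_%:E); exact: (near qE r).
have rhoq : 1 < rho * (a0 / (n%:R * tau 0)).
  have cqV : n%:R * r / kfun nu tau r @[r --> 0^'+] --> (a0 / (n%:R * tau 0))^-1.
    apply: cvg_trans (cvgV (lt0r_neq0 q0) cq); apply: near_eq_cvg.
    by near=> r; exact: (near qE r).
  move: rho_gt; rewrite /critical_density.
  rewrite (_ : lim _ = ((a0 / (n%:R * tau 0))^-1)%:E).
    by rewrite lte_fin -ltr_pdivrMr// div1r.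
  apply: cvg_lim => //; apply: cvg_EFin; first by near=> r.
  exact: cqV.
(* The limit of the growth rate, equal to [tau 0 * (rho / rho_c - 1)]; half of it is a lower bound
   near 0. *)
pose kappa := rho / n%:R * a0 - tau 0.
have kappa0 : 0 < kappa.
  rewrite /kappa (_ : _ - _ = tau 0 * (rho * (a0 / (n%:R * tau 0)) - 1)).
    by rewrite mulr_gt0 ?tau_gt0// subr_gt0.
  by field; rewrite !gt_eqF ?tau_gt0.
exists (kappa / 2); first by rewrite divr_gt0.
have ck : rho / n%:R * (nu r / r) - tau r @[r --> 0^'+] --> kappa.
  by apply: cvgB => //; exact: cvgMr.
by apply: (cvgr_ge kappa) => //; lra.
Unshelve. all: by end_near. Qed.

End critical_density.

(** * Elementary bounds *)

Lemma bounded_exists {R : realType} (A : set R) (g : R -> R) :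
  [bounded g r | r in A] -> exists2 K : R, 0 < K & forall r, A r -> `|g r| <= K.
Proof.
move=> [K0 [_ bK]]; exists (`|K0| + 1); first by rewrite ltr_wpDl.
by move=> r Ar; apply: bK => //; rewrite ltr_pwDr// ler_norm.
Qed.

(** Each [|x_i| |x_j|] is at most [|x|^2]. This controls [J M J^T] in the Gronwall estimate and the
    deviation of [M] from its limit in the long-time one. *)
Lemma quadratic_form_bound {R : realType} n (x : 'rV[R]_n) (M : 'I_n -> 'I_n -> R) :
  `|\sum_i x ord0 i * \sum_j x ord0 j * M i j| <= dotp x x * \sum_i \sum_j `|M i j|.
Proof.
apply: le_trans (ler_norm_sum _ _ _) _; rewrite mulr_sumr; apply: ler_sum => i _.
rewrite mulr_sumr [leRHS]mulr_sumr; apply: le_trans (ler_norm_sum _ _ _) _.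
apply: ler_sum => j _; rewrite mulrA !normrM ler_wpM2r//.
by rewrite -sqr_enorm expr2 ler_pM// coord_le_enorm.
Qed.

(** * Evolution of the squared momentum *)

Section momentum_dynamics.
Context {R : realType} {n : nat}.
Variables (nu tau : R -> R) (F : R -> sphere_distribution R n).
Hypothesis n_gt0 : (0 < n)%N.
Hypothesis linF : forall t : R, 0 < t -> poly_linear (F t).
Hypothesis derF : forall (t : R) phi, 0 < t -> smooth_sphere phi ->
  is_derive t 1 (fun t' : R => F t' phi) (Qop nu tau (F t) phi).
Hypothesis nu_bnd : [bounded nu r / r | r in [set r : R | 0 < r]].
Hypothesis tau_bnd : [bounded tau r | r in [set r : R | 0 <= r]].

Let mass (t : R) : R := F t (fun=> 1).
Let second t i j := F t (fun w => w ord0 i * w ord0 j).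
Let energy (t : R) : R := dotp (momentum (F t)) (momentum (F t)).
(** Half the time derivative of [energy]; the double sum is [J M J^T]. *)
Let rate t := let J := momentum (F t) in let r := enorm J in
  nu r / r * (energy t * mass t
    - \sum_i J ord0 i * \sum_j J ord0 j * second t i j)
  - (n%:R - 1) * tau r * energy t.

Lemma is_derive_energy (t : R) : 0 < t -> is_derive t 1 energy (2 * rate t).
Proof.
move=> t0.
have sc i : smooth_sphere (fun w : 'rV[R]_n => w ord0 i) 
  by exact/sphere_poly_smooth/SPcoord.
have -> : energy =
    \sum_i (fun t => F t (fun w => w ord0 i)) * (fun t => F t (fun w => w ord0 i)).
  apply/funext => s; rewrite fct_sumE; apply: eq_bigr => i _.
  by rewrite !mxE.
apply: is_derive_eq.
  apply: is_derive_sum => i; apply: is_deriveM; exact: (derF t0 (sc i)).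
rewrite /rate /GRing.scale/=.
set J := momentum _; set r := enorm _.
have JE i : F t (fun w => w ord0 i) = J ord0 i by rewrite mxE.
transitivity (\sum_i 2 * (nu r / r * (J ord0 i * J ord0 i * mass t
    - J ord0 i * \sum_j J ord0 j * second t i j)
    - (n%:R - 1) * tau r * (J ord0 i * J ord0 i))).
  apply: eq_bigr => i _; rewrite Qop_coord ?JE; last exact: linF.
  rewrite -/J -/r -/(mass t) -/(second t i _); ring.
rewrite -mulr_sumr sumrB -!mulr_sumr sumrB -mulr_suml.
by [].
Qed.

Lemma continuous_observable phi (t : R) : 0 < t -> smooth_sphere phi ->
  {for t, continuous (fun t => F t phi)}.
Proof.
move=> t0 sp; apply: differentiable_continuous; apply/derivable1_diffP.
by case: (derF t0 sp).
Qed.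

Lemma smooth_coord2 i j : smooth_sphere (fun w : 'rV[R]_n => w ord0 i * w ord0 j).
Proof. by apply: sphere_poly_smooth; apply: SPmul; exact: SPcoord. Qed.

(** At [r = 0], which [nu_bnd] leaves out, the quotient is 0 by the convention on division. *)
Lemma drift_bound : exists2 A : R, 0 < A & forall r : R, 0 <= r -> `|nu r / r| <= A.
Proof.
have [A A0 bA] := bounded_exists nu_bnd; exists A => // r.
rewrite le_eqVlt => /predU1P[<-|]; last exact: bA.
by rewrite invr0 mulr0 normr0 ltW.
Qed.

(** Gronwall forward from a time [e] of positive energy: on [[e, T]] the derivative is at least
    [- C * energy], so [energy t * expR (C * t)] is nondecreasing. The start is at [e > 0] because
    the equation holds at positive times. *)
Lemma energy_gt0 : (\forall t \near 0^'+, 0 < energy t) ->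
  forall t : R, 0 < t -> 0 < energy t.
Proof.
move=> near0 T T0.
have [A A0 bA] := drift_bound.
have [B B0 bB] := bounded_exists tau_bnd.
have [e [/andP[e0 eT] Ee]] : exists e, 0 < e < T /\ 0 < energy e.
  near (0 : R)^'+ => e; exists e; split; last exact: (near near0 e).
  apply/andP; split; near: e; [exact: nbhs_right_gt|exact: nbhs_right_lt].
(* [S] controls the moments that enter [rate]; by continuity it has a maximum [S c] on [[e, T]]. *)
pose S t := `|mass t| + \sum_i \sum_j `|second t i j|.
have cS : {within `[e, T], continuous S}.
  apply: continuous_in_subspaceT => t; rewrite inE/= in_itv/= => /andP[et _].
  have t0 := lt_le_trans e0 et.
  apply: cvgD.
    apply: cvg_norm; apply: continuous_observable => //.
    exact/sphere_poly_smooth/SPcst.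
  apply: cvg_big => [|i _]; first exact: add_continuous.
  apply: cvg_big => [|j _]; first exact: add_continuous.
  apply: cvg_norm; apply: continuous_observable => //; exact: smooth_coord2.
have [c cI Sc] := EVT_max (ltW eT) cS.
(* Twice the sum of the possible losses in [rate] per unit of energy: [A * S c] from the drift, and
   [(n - 1) * tau <= n * B] from the diffusion. *)
pose C := 2 * (A * S c + n%:R * B).
pose G t := energy t * expR (C * t).
have derG (t : R) : 0 < t ->
    is_derive t 1 G ((2 * rate t + C * energy t) * expR (C * t)).
  move=> t0; have dE := is_derive_energy t0.
  have dX : is_derive t 1 (fun t => expR (C * t)) (expR (C * t) * C).
    apply: (@is_derive1_comp _ expR (fun t => C * t)).
    apply: is_derive_eq.
    by rewrite /GRing.scale/= mulr1.
  apply: is_derive_eq.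
  by rewrite /GRing.scale/=; ring.
have rate_ge t : e <= t <= T -> 0 <= 2 * rate t + C * energy t.
  move=> /andP[et tT]; have t0 := lt_le_trans e0 et.
  have E0 : 0 <= energy t by exact: dotp_ge0.
  have St : S t <= S c by apply: Sc; rewrite in_itv/= et.
  set r := enorm (momentum (F t)); have r0 : 0 <= r := enorm_ge0 _.
  pose D := energy t * mass t - \sum_i momentum (F t) ord0 i
     * \sum_j momentum (F t) ord0 j * second t i j.
  have DE : `|D| <= energy t * S t.
    rewrite /D (le_trans (ler_normB _ _))// [leRHS]mulrDr lerD//.
      by rewrite normrM ger0_norm.
    exact: quadratic_form_bound.
  have aD : `|nu r / r * D| <= A * (energy t * S c).
    rewrite normrM ler_pM ?bA// (le_trans DE)// ler_wpM2l//.
  have tE : (n%:R - 1) * tau r * energy t <= n%:R * B * energy t.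
    rewrite ler_wpM2r// (le_trans (ler_norm _))// normrM ler_pM ?bB//.
    rewrite ger0_norm ?subr_ge0 ?ler1n//; lra.
  rewrite /rate -/r -/D /C; move: aD; rewrite ler_norml => /andP[aD _].
  nra.
have GeT : G e <= G T.
  apply: (@ger0_derive1_le_cc _ G e T); rewrite ?in_itv/= ?lexx ?ltW//.
  - move=> t; rewrite in_itv/= => /andP[et _].
    by case: (derG _ (lt_trans e0 et)).
  - move=> t; rewrite in_itv/= => /andP[et tT].
    have dG := derG _ (lt_trans e0 et).
    rewrite derive1E (@derive_val _ _ _ _ _ _ _ dG) mulr_ge0 ?expR_ge0//.
    by rewrite rate_ge// !ltW.
  - apply: derivable_within_continuous => t; rewrite in_itv/= => /andP[et _].
    by case: (derG _ (lt_le_trans e0 et)).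
have : 0 < G T by apply: lt_le_trans GeT; rewrite mulr_gt0 ?expR_gt0.
by rewrite pmulr_lgt0 ?expR_gt0.
Unshelve. all: by end_near. Qed.

(** [rate] splits into its value at the uniform moments, at least [kappa * energy] by the growth
    hypothesis, and a remainder of size at most [kappa * energy]; hence it is eventually
    nonnegative. *)
Lemma energy_not_cvg0 (rho kappa : R) : (1 < n)%N -> 0 < kappa ->
  (\forall r \near 0^'+, kappa <= rho / n%:R * (nu r / r) - tau r) ->
  mass t @[t --> +oo] --> rho ->
  (forall i j, second t i j @[t --> +oo] --> (i == j)%:R * (rho / n%:R)) ->
  (forall t : R, 0 < t -> 0 < energy t) ->
  ~ (enorm (momentum (F t)) @[t --> +oo] --> 0).
Proof.
move=> n1 kappa0 growth cmass csecond Epos cJ.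
have n0 : 0 < n%:R :> R by rewrite ltr0n.
have [A A0 bA] := drift_bound.
have [d d0 growth_d] : exists2 d : R, 0 < d & forall r, 0 < r < d ->
    kappa <= rho / n%:R * (nu r / r) - tau r.
  move: growth => [d /= d0 growth]; exists d => // r /andP[r0 rd].
  by apply: growth => //=; rewrite sub0r normrN gtr0_norm.
(* Deviation of the moments from those of the uniform density of mass [rho]. *)
pose S t := `|mass t - rho|
  + \sum_i \sum_j `|second t i j - (i == j)%:R * (rho / n%:R)|.
have cS : S t @[t --> +oo] --> 0.
  have -> : 0 = `|rho - rho| + \sum_(i < n) \sum_(j < n)
      `|(i == j)%:R * (rho / n%:R) - (i == j)%:R * (rho / n%:R)| :> R.
    rewrite subrr normr0 add0r big1 // => i _; rewrite big1 // => j _.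
    by rewrite subrr normr0.
  apply: cvgD; first by apply: cvg_norm; apply: cvgB => //; exact: cvg_cst.
  apply: cvg_big => [|i _]; first exact: add_continuous.
  apply: cvg_big => [|j _]; first exact: add_continuous.
  by apply: cvg_norm; apply: cvgB => //; exact: cvg_cst.
(* The threshold [kappa / A] makes the remainder, at most [A * energy * S], no larger than the gain
   [kappa * energy]. *)
have [T0 T0_gt0 HT] : exists2 T0 : R, 0 < T0 & forall t, T0 <= t ->
    enorm (momentum (F t)) < d /\ S t <= kappa / A.
  have : \forall t \near +oo, enorm (momentum (F t)) < d /\ S t <= kappa / A.
    near=> t; split; near: t; [exact: cvgr_lt cJ _ d0|].
    by apply: (cvgr_le _ cS); rewrite divr_gt0.
  move=> [M [_ HM]]; exists (`|M| + 1); first by rewrite ltr_wpDl.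
  move=> t Mt; apply: HM; apply: lt_le_trans Mt.
  by rewrite ltr_pwDr// ler_norm.
have rate_ge0 t : T0 <= t -> 0 <= 2 * rate t.
  move=> tT; have [rd St] := HT _ tT; have t0 := lt_le_trans T0_gt0 tT.
  have E0 := Epos _ t0.
  set J := momentum (F t); set r := enorm J.
  have r0 : 0 < r by rewrite lt0r enorm_eq0 enorm_ge0 andbT -dotp_eq0 gt_eqF.
  pose D := energy t * (mass t - rho) - \sum_i J ord0 i
     * \sum_j J ord0 j * (second t i j - (i == j)%:R * (rho / n%:R)).
  have DE : `|D| <= energy t * S t.
    rewrite /D (le_trans (ler_normB _ _))// [leRHS]mulrDr lerD//.
      by rewrite normrM gtr0_norm.
    exact: quadratic_form_bound.
  have aD : `|nu r / r * D| <= kappa * energy t.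
    apply: (@le_trans _ _ (A * (energy t * (kappa / A)))).
      by rewrite normrM ler_pM ?(bA _ (ltW r0))// (le_trans DE)// ler_wpM2l// ltW.
    by rewrite le_eqVlt; apply/orP; left; apply/eqP; field; rewrite gt_eqF.
  (* At mass [rho] and second moments [(rho / n) Id] the left-hand side is
     [rho * energy - rho / n * energy]; [D] collects the deviations. *)
  have eqD : energy t * mass t - \sum_i J ord0 i * \sum_j J ord0 j * second t i j =
      D + rho / n%:R * (n%:R - 1) * energy t.
    have -> : \sum_i J ord0 i * \sum_j J ord0 j * second t i j =
        (\sum_i J ord0 i * \sum_j J ord0 j * (second t i j - (i == j)%:R * (rho / n%:R)))
        + energy t * (rho / n%:R).
      rewrite /energy -/J /dotp mulr_suml -big_split/=; apply: eq_bigr => i _.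
      rewrite -mulrA -mulrDr; congr (_ * _).
      rewrite -(sumr_delta (fun j => J ord0 j * (rho / n%:R)) i) -big_split/=.
      by apply: eq_bigr => j _; ring.
    rewrite /D; field; by rewrite gt_eqF.
  have g : kappa <= rho / n%:R * (nu r / r) - tau r by apply: growth_d; rewrite r0.
  (* Here [n >= 2] enters: the factor [n - 1] does not shrink the growth rate. *)
  have n2 : 1 <= n%:R - 1 :> R by rewrite lerBrDr -(natrD _ 1 1) ler_nat.
  have h : kappa * energy t <=
      (n%:R - 1) * (rho / n%:R * (nu r / r) - tau r) * energy t.
    rewrite ler_wpM2r ?(ltW E0)//; apply: le_trans (g) _.
    by rewrite ler_peMl// (le_trans (ltW kappa0) g).
  rewrite /rate -/J -/r eqD; move: aD; rewrite ler_norml => /andP[aD _].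
  have -> : nu r / r * (D + rho / n%:R * (n%:R - 1) * energy t)
      - (n%:R - 1) * tau r * energy t =
      nu r / r * D + (n%:R - 1) * (rho / n%:R * (nu r / r) - tau r) * energy t by ring.
  lra.
have Emono t : T0 <= t -> energy T0 <= energy t.
  move=> T0t; apply: (@ger0_derive1_ndecry _ _ T0) => //.
  - move=> s; rewrite in_itv/= andbT => sT.
    by case: (is_derive_energy (lt_trans T0_gt0 sT)).
  - move=> s; rewrite in_itv/= andbT => sT.
    have dE := is_derive_energy (lt_trans T0_gt0 sT).
    by rewrite derive1E (@derive_val _ _ _ _ _ _ _ dE) rate_ge0// ltW.
  - apply: derivable_within_continuous => s; rewrite in_itv/= andbT => sT.
    by case: (is_derive_energy (lt_le_trans T0_gt0 sT)).
(* From [T0] on the energy stays above [energy T0], so its limit 0 does too, against positivity. *)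
have : energy T0 <= 0.
  have cE : energy t @[t --> +oo] --> 0.
    have -> : energy = (fun t => enorm (momentum (F t)) * enorm (momentum (F t))).
      by apply/funext => t; rewrite -expr2 sqr_enorm.
    by rewrite -(mulr0 0); exact: cvgM.
  apply: (cvgr_to_ge cE); near=> t; apply: Emono.
  by near: t; apply: nbhs_pinfty_ge; exact: num_real.
by rewrite leNgt Epos.
Unshelve. all: by end_near. Qed.

End momentum_dynamics.

(** * Properties of solutions and conclusion *)

Lemma solution_poly_linear {R : realType} n (sigma : probability (borel_rV R n) R)
    nu tau f0 (f : R -> sphere_distribution R n) (t : R) :
  uniform_sphere sigma -> is_solution sigma nu tau f0 f -> 0 < t ->
  poly_linear (f t).
Proof.
move=> unif [[u [du smooth_u] fu] _ _ _] t0.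
have [su _ _ _] := smooth_u t t0.
have [lin ext] := poly_linear_density (sigma_sphere_lty unif)
  (smooth_sphere_continuous su).
split => [c g h pg ph|g h pg gh].
  (* [f t] is known to be a density on smooth test functions only; polynomials qualify. *)
  rewrite !fu// ?lin//; apply: sphere_poly_smooth => //.
  by apply: SPadd => //; apply: SPmul => //; exact: SPcst.
have ph : sphere_poly h by apply: (SPeq _ pg) => w w1; rewrite gh.
by rewrite !fu ?(ext _ _ pg gh)//; exact: sphere_poly_smooth.
Qed.

(** Weak continuity at time 0, tested on the coordinates, carries the nonzero initial momentum to
    small positive times. *)
Lemma solution_energy_gt0 {R : realType} n (sigma : probability (borel_rV R n) R)
    nu tau (f0 : {finite_measure set (borel_rV R n) -> \bar R})
    (f : R -> sphere_distribution R n) :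
  is_solution sigma nu tau f0 f -> momentum (dist_measure f0) != 0 ->
  \forall t \near 0^'+, 0 < dotp (momentum (f t)) (momentum (f t)).
Proof.
move=> [_ _ f0E cf] J0.
pose J i := f 0 (fun w => w ord0 i).
have cE : dotp (momentum (f t)) (momentum (f t)) @[t --> 0^'+] --> \sum_i J i * J i.
  apply: cvg_big => [|i _]; first exact: add_continuous.
  have ci : momentum (f t) ord0 i @[t --> 0^'+] --> J i.
    under eq_fun do rewrite mxE.
    exact/cf/sphere_poly_smooth/SPcoord.
  exact: cvgM.
apply: (cvgr_gt _ cE).
have -> : \sum_i J i * J i =
    dotp (momentum (dist_measure f0)) (momentum (dist_measure f0)).
  by apply: eq_bigr => i _; rewrite !mxE /J f0E//; exact/sphere_poly_smooth/SPcoord.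
by rewrite lt0r dotp_eq0 J0 dotp_ge0.
Qed.

Unset Implicit Arguments.

Theorem proposition3p3 (R : realType) (n : nat) (n_ge2 : (2 <= n)%N)
  (sigma : probability (borel_rV R n) R) (sigma_unif : uniform_sphere sigma)
  (nu tau : R -> R)
  (nu_ge0 : forall r : R, 0 <= r -> 0 <= nu r)
  (tau_gt0 : forall r : R, 0 <= r -> 0 < tau r)
  (nu_lip : [lipschitz nu r / r | r in [set r : R | 0 < r]])
  (nu_bnd : [bounded nu r / r | r in [set r : R | 0 < r]])
  (tau_lip : [lipschitz tau r | r in [set r : R | 0 <= r]])
  (tau_bnd : [bounded tau r | r in [set r : R | 0 <= r]])
  (k_incr : forall r s : R, 0 <= r -> r < s -> kfun nu tau r < kfun nu tau s)
  (f0 : {finite_measure set (borel_rV R n) -> \bar R})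
  (f0_sphere : f0 (~` sphere R n) = 0%E)
  (rho : R) (f0_mass : f0 (sphere R n) = rho%:E)
  (f : R -> sphere_distribution R n) (f_sol : is_solution sigma nu tau f0 f)
  (rho_gt : (critical_density n (kfun nu tau) < rho%:E)%E)
  (J0_neq0 : momentum (dist_measure f0) != 0) :
  ~ (enorm (momentum (f t)) @[t --> +oo] --> (0 : R) /\
     forall s : R,
       sobolev_norm sigma s (f t \- dist_density sigma (cst rho))
         @[t --> +oo] --> (0%E : \bar R)).
Proof.
move=> [cJ cf].
have n_gt0 : (0 < n)%N by exact: ltnW.
have linf (t : R) (t0 : 0 < t) := solution_poly_linear sigma_unif f_sol t0.
have near0 := solution_energy_gt0 f_sol J0_neq0.
have [_ derf _ _] := f_sol.
have Epos := energy_gt0 n_gt0 linf derf nu_bnd tau_bnd near0.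
have [kappa kappa0 growth] :=
  supercritical_growth n_gt0 nu_ge0 tau_gt0 nu_lip tau_lip k_incr rho_gt.
have c0 := cf 0.
exact: (energy_not_cvg0 n_gt0 linf derf nu_bnd n_ge2 kappa0 growth
  (sobolev_cvg_mass sigma_unif c0) (sobolev_cvg_coord2 sigma_unif linf c0) Epos cJ).
Qed.
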